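(* Let $I=[a,b]$ be a compact interval, let $(X,d)$ be a complete metric space, let $g:I\to\mathbb R$ be left-continuous and nondecreasing, let $\alpha>1$, and let $F:I\to\mathcal K(X)$ be $g$-Hölder of exponent $\alpha$ with $L=[F]_{\alpha,g}<\infty$. Then, for every $a\le s<t\le b$, $$V_H(F;[s,t])=\sum_{\tau\in[s,t)}J_F(\tau)=\sum_{\tau\in[s,t)}d_H(F(\tau+),F(\tau)).$$ Moreover, $$\sum_{\tau\in[s,t)}J_F(\tau)\le L\sum_{\tau\in[s,t)}[\Delta^+g(\tau)]^\alpha.$$
   Context: $\mathcal K(X)$ is the family of all nonempty compact subsets of $X$ with Hausdorff distance $d_H$. $F$ is $g$-Hölder of exponent $\alpha$ if there is $L\ge0$ with $d_H(F(s),F(t))\le L|g(t)-g(s)|^\alpha$ for all $s,t\in I$; $[F]_{\alpha,g}$ is the minimum such $L$. $V_H(F;[s,t])=\sup_P\sum_{i=1}^n d_H(F(t_{i-1}),F(t_i))$ over all finite partitions $P:s=t_0<\cdots<t_n=t$. For $\tau\in[a,b)$, $\Delta^+g(\tau)=g(\tau+)-g(\tau)$ with $g(\tau+)=\lim_{r\downarrow\tau}g(r)$; $F(\tau+)=\lim_{r\downarrow\tau}F(r)$ is the right limit in $(\mathcal K(X),d_H)$ (under the stated hypotheses this limit exists for every $\tau\in[a,b)$); and $J_F(\tau)=d_H(F(\tau+),F(\tau))$. *)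

(* Defs.v *)
From HB Require Import structures.
From mathcomp Require Import all_boot all_order all_algebra.
From mathcomp Require Import all_classical all_reals all_analysis.

Set Implicit Arguments.
Unset Strict Implicit.
Unset Printing Implicit Defensive.

Import Order.TTheory GRing.Theory Num.Theory.
Import numFieldNormedType.Exports.

Local Open Scope classical_set_scope.
Local Open Scope ring_scope.

(* The library's complete spaces carry a base point; any nonempty complete
   metric space can be given one. *)
#[short(type="completeMetricType")]
HB.structure Definition CompleteMetric (K : numDomainType) :=
  {M of CompletePseudoMetric K M & Metric K M}.

(* [dist_to_set x B] and [hausdorff_dist A B] are meant for nonempty bounded
   sets, as [inf] and [sup] are real-valued. *)
Definition dist_to_set (R : realType) (X : metricType R) (x : X) (B : set X)
  : R := inf [set mdist x y | y in B].

Definition hausdorff_dist (R : realType) (X : metricType R) (A B : set X) : R :=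
  Num.max (sup [set dist_to_set x B | x in A])
          (sup [set dist_to_set y A | y in B]).

Record compacts (R : realType) (X : metricType R) := Compacts {
  cset :> set X;
  cset_compact : compact cset;
  cset_nonempty : cset !=set0 }.

Lemma cset_inj (R : realType) (X : metricType R) : injective (@cset R X).
Proof.
move=> [A cA nA] [B cB nB] /= AB; subst B.
by rewrite (Prop_irrelevance cA cB) (Prop_irrelevance nA nB).
Qed.

Section hausdorff_metric.
Context {R : realType} {X : metricType R}.
Implicit Types (A B C : compacts X) (x y z : X).

Let has_lbound_dist x (S : set X) : has_lbound [set mdist x y | y in S].
Proof. by exists 0 => _ [y _ <-]; exact: mdist_ge0. Qed.

Lemma dist_to_set_le x y (S : set X) : S y -> dist_to_set x S <= mdist x y.
Proof. by move=> Sy; apply: ge_inf; [exact: has_lbound_dist|exists y]. Qed.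

Lemma le_dist_to_set x B (r : R) :
  (forall y, cset B y -> r <= mdist x y) -> r <= dist_to_set x B.
Proof.
move=> rB; apply: lb_le_inf; last by move=> _ [y By <-]; exact: rB.
by have [y By] := cset_nonempty B; exists (mdist x y), y.
Qed.

Lemma dist_to_set_ge0 x B : 0 <= dist_to_set x B.
Proof. by apply: le_dist_to_set => y _; exact: mdist_ge0. Qed.

Lemma dist_to_set_triangle x y B :
  dist_to_set x B <= mdist x y + dist_to_set y B.
Proof.
rewrite -lerBlDl; apply: le_dist_to_set => z Bz; rewrite lerBlDl.
by rewrite (le_trans (dist_to_set_le x Bz))// metric_triangle.
Qed.

Lemma continuous_mdist x : continuous (fun y => mdist x y : R).
Proof.
move=> y; apply/cvgrPdist_le => e e0; near=> z.
have yz : mdist y z <= e.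
  near: z.
  by apply: (metricType_numDomainType.cvgr_dist_le (f := id)) => //; exact: cvg_id.
rewrite ler_norml; apply/andP; split.
  rewrite lerBrDr addrC lerBlDr (le_trans (metric_triangle x y z))//.
  by rewrite lerD2l.
rewrite lerBlDr (le_trans (metric_triangle x z y))//.
by rewrite addrC lerD2r metric_sym.
Unshelve. all: by end_near. Qed.

Lemma has_ubound_dist A B : has_ubound [set dist_to_set x B | x in A].
Proof.
have [y By] := cset_nonempty B.
have cA : compact [set mdist y x | x in A].
  apply: continuous_compact; last exact: cset_compact.
  by apply: continuous_subspaceT; exact: continuous_mdist.
have [M [_ MA]] := compact_bounded (V := R^o) cA.
exists (M + 1) => _ [x Ax <-].
rewrite (le_trans (dist_to_set_le x By))// metric_sym.
rewrite (le_trans (ler_norm _))//; apply: (MA (M + 1)); first by rewrite ltrDl.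
by exists x.
Qed.

Lemma dist_to_set_le_hausdorff A B x : cset A x ->
  dist_to_set x B <= hausdorff_dist A B.
Proof.
move=> Ax; rewrite /hausdorff_dist le_max; apply/orP; left.
by apply: ub_le_sup; [exact: has_ubound_dist|exists x].
Qed.

Lemma hausdorff_dist_le A B (r : R) :
  (forall x, cset A x -> dist_to_set x B <= r) ->
  (forall y, cset B y -> dist_to_set y A <= r) -> hausdorff_dist A B <= r.
Proof.
move=> Ar Br; rewrite /hausdorff_dist ge_max; apply/andP; split; apply: ge_sup.
- by have [x Ax] := cset_nonempty A; exists (dist_to_set x B), x.
- by move=> _ [x Ax <-]; exact: Ar.
- by have [y By] := cset_nonempty B; exists (dist_to_set y A), y.
- by move=> _ [y By <-]; exact: Br.
Qed.

Lemma hausdorff_dist_sym A B : hausdorff_dist A B = hausdorff_dist B A.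
Proof. by rewrite /hausdorff_dist maxC. Qed.

Lemma hausdorff_dist_ge0 A B : 0 <= hausdorff_dist A B.
Proof.
have [x Ax] := cset_nonempty A.
by rewrite (le_trans (dist_to_set_ge0 x B))// dist_to_set_le_hausdorff.
Qed.

Lemma hausdorff_distxx A : hausdorff_dist A A = 0.
Proof.
apply/eqP; rewrite eq_le hausdorff_dist_ge0 andbT.
by apply: hausdorff_dist_le => x Ax; rewrite (le_trans (dist_to_set_le x Ax))//
  mdistxx.
Qed.

Let dist_to_set_triangle_hausdorff A B C x : cset A x ->
  dist_to_set x C <= hausdorff_dist A B + hausdorff_dist B C.
Proof.
move=> Ax; apply: (@le_trans _ _ (dist_to_set x B + hausdorff_dist B C)).
  rewrite -lerBlDr; apply: le_dist_to_set => y By; rewrite lerBlDr.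
  by rewrite (le_trans (dist_to_set_triangle x y C))// lerD2l
    dist_to_set_le_hausdorff.
by rewrite lerD2r dist_to_set_le_hausdorff.
Qed.

Lemma hausdorff_dist_triangle B A C :
  hausdorff_dist A C <= hausdorff_dist A B + hausdorff_dist B C.
Proof.
apply: hausdorff_dist_le => x; first exact: dist_to_set_triangle_hausdorff.
rewrite addrC (hausdorff_dist_sym B C) (hausdorff_dist_sym A B).
exact: dist_to_set_triangle_hausdorff.
Qed.

Let hausdorff_dist0_sub A B : hausdorff_dist A B = 0 -> cset A `<=` B.
Proof.
move=> AB0 x Ax.
have B_closed : closed (cset B).
  by apply: compact_closed; [exact: metric_hausdorff|exact: cset_compact].
apply: B_closed => U /nbhs_ballP[e /= e0 xeU].
have /inf_adherent : 0 < e by [].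
move=> /(_ [set mdist x y | y in B])[].
  split; last exact: has_lbound_dist.
  by have [y By] := cset_nonempty B; exists (mdist x y), y.
move=> _ [y By <-] xye; exists y; split => //; apply: xeU.
rewrite ballEmdist/= (lt_le_trans xye)// gerDr -AB0.
exact: dist_to_set_le_hausdorff.
Qed.

Lemma hausdorff_dist_positivity A B : hausdorff_dist A B = 0 -> A = B.
Proof.
move=> AB0; apply: cset_inj; apply/seteqP; split.
  exact: hausdorff_dist0_sub.
by apply: hausdorff_dist0_sub; rewrite hausdorff_dist_sym.
Qed.

End hausdorff_metric.

HB.instance Definition _ (R : realType) (X : metricType R) :=
  gen_eqMixin (compacts X).
HB.instance Definition _ (R : realType) (X : metricType R) :=
  gen_choiceMixin (compacts X).
HB.instance Definition _ (R : realType) (X : metricType R) :=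
  @isMetric.Build R (compacts X) (fun A B => hausdorff_dist A B)
    hausdorff_distxx hausdorff_dist_positivity hausdorff_dist_sym
    hausdorff_dist_triangle.

Lemma mdist_compactsE (R : realType) (X : metricType R) (A B : compacts X) :
  mdist A B = hausdorff_dist A B.
Proof. by []. Qed.

(* The base point only serves to make [lim] total on [compacts X]. *)
HB.instance Definition _ (R : realType) (X : completeMetricType R) :=
  isPointed.Build (compacts X)
    (Compacts (@compact_set1 X point) (ex_intro _ point erefl)).

(* As for [variation], [p] lists t_1, ..., t_n = t, without t_0 = s. *)
Definition mvariation (R : realType) (M : metricType R) (s t : R) (F : R -> M)
    (p : seq R) : R :=
  let T := nth t (s :: p) in
  \sum_(0 <= i < size p) mdist (F (T i)) (F (T i.+1)).

Definition total_mvariation (R : realType) (M : metricType R) (s t : R)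
    (F : R -> M) : \bar R :=
  ereal_sup [set (mvariation s t F p)%:E | p in itv_partition s t].

Definition holder_bounds (R : realType) (M : metricType R) (a b alpha : R)
    (g : R -> R) (F : R -> M) : set R :=
  [set L | 0 <= L /\ forall s t, s \in `[a, b] -> t \in `[a, b] ->
     mdist (F s) (F t) <= L * `|g t - g s| `^ alpha].

Definition gholder (R : realType) (M : metricType R) (a b alpha : R)
    (g : R -> R) (F : R -> M) : Prop :=
  holder_bounds a b alpha g F !=set0.

Definition holder_const (R : realType) (M : metricType R) (a b alpha : R)
    (g : R -> R) (F : R -> M) : R :=
  inf (holder_bounds a b alpha g F).

Lemma holder_const_minimum (R : realType) (M : metricType R) (a b alpha : R)
    (g : R -> R) (F : R -> M) : gholder a b alpha g F ->
  holder_bounds a b alpha g F (holder_const a b alpha g F) /\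
  lbound (holder_bounds a b alpha g F) (holder_const a b alpha g F).
Proof.
move=> hF; have lb : has_lbound (holder_bounds a b alpha g F).
  by exists 0 => L [].
split; last exact: ge_inf.
split=> [|s t sI tI]; first by apply: lb_le_inf => // L [].
have [c0|c_gt0] := leP (`|g t - g s| `^ alpha) 0.
  have {}c0 : `|g t - g s| `^ alpha = 0.
    by apply/eqP; rewrite eq_le c0 powR_ge0.
  by have [L [_ /(_ _ _ sI tI)]] := hF; rewrite c0 !mulr0.
rewrite -ler_pdivrMr//; apply: lb_le_inf => // L [_ /(_ _ _ sI tI)].
by rewrite ler_pdivrMr.
Qed.

Definition right_jump (R : realType) (g : R -> R) (tau : R) : R :=
  lim (g @ tau^'+) - g tau.

Definition set_jump (R : realType) (X : completeMetricType R)
    (F : R -> compacts X) (tau : R) : R :=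
  hausdorff_dist (lim (F @ tau^'+)) (F tau).

(* Main.v *)
(* Write J for the jump of F and fix e > 0. Just after a point c, the Hoelder
   bound with exponent alpha > 1 gives d(F(c+), F(y)) <= e (g(y) - g(c)), so
   d(F(c), F(y)) <= J(c) + e (g(y) - g(c)). Together with left continuity, a
   continuous induction turns this into
   d(F(s), F(t)) <= \sum_[s,t) J + e (g(t) - g(s)), hence the variation is at
   most the sum of the jumps. The converse inequality isolates each of finitely
   many jumps in a short interval to its right, and the last one passes to the
   limit in the Hoelder bound. Right limits of F exist because the compact sets
   are complete for the Hausdorff distance: the limit of a Cauchy filter
   consists of the points whose distance to its members tends to 0. *)
Require Import Defs.
From HB Require Import structures.
From mathcomp Require Import all_boot all_order all_algebra.
From mathcomp Require Import all_classical all_reals all_analysis.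
From mathcomp Require Import finmap ring lra.

Set Implicit Arguments.
Unset Strict Implicit.
Unset Printing Implicit Defensive.

Import Order.TTheory GRing.Theory Num.Theory.
Import numFieldNormedType.Exports.

Local Open Scope classical_set_scope.
Local Open Scope ring_scope.

(* The library versions live over a [realFieldType]; unifying them with a
   [realType] yields instances of [mdist] that [lra] does not identify. *)
Lemma mdist_triangle (R : realType) (M : metricType R) (y x z : M) :
  mdist x z <= mdist x y + mdist y z.
Proof. exact: metric_triangle. Qed.

Lemma mdistC (R : realType) (M : metricType R) (x y : M) :
  mdist x y = mdist y x.
Proof. exact: metric_sym. Qed.

Lemma dist_to_set_lipschitz (R : realType) (X : metricType R) (A B : compacts X)
    (x : X) : dist_to_set x B <= dist_to_set x A + hausdorff_dist A B.
Proof.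
rewrite -lerBlDr; apply: le_dist_to_set => y Ay; rewrite lerBlDr.
rewrite (le_trans (dist_to_set_triangle x y B))// lerD2l.
exact: dist_to_set_le_hausdorff.
Qed.

Lemma dist_to_set_lt (R : realType) (X : metricType R) (B : compacts X) (x : X)
    (r : R) : dist_to_set x B < r -> exists2 y, cset B y & mdist x y < r.
Proof.
move=> xBr; apply: contrapT => noy; move: xBr; apply/negP; rewrite -leNgt.
apply: le_dist_to_set => y By; rewrite leNgt; apply/negP => xyr.
by apply: noy; exists y.
Qed.

(* Projecting the ultrafilter to a nearby compact set gives a cluster point
   there, and an ultrafilter is eventually close to such a point: no finite
   covers are needed. *)
Lemma ultra_cvg_near_compacts (R : realType) (X : completeMetricType R)
    (U : set_system X) : UltraFilter U ->
  (forall e : R, 0 < e -> exists A : compacts X,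
     U [set x | dist_to_set x A < e]) ->
  cvg U.
Proof.
move=> UU Uclose; apply/cauchy_cvgP/cauchy_exP => e e0.
have [|A UA] := Uclose (e / 2); first by rewrite divr_gt0.
have /choice[p pA] : forall x, exists y, cset A y /\
    (dist_to_set x A < e / 2 -> mdist x y < e / 2).
  move=> x; have [xA|_] := ltP (dist_to_set x A) (e / 2).
    by have [y Ay xy] := dist_to_set_lt xA; exists y.
  by have [y Ay] := cset_nonempty A; exists y.
have pUA : (p @ U) (cset A).
  by rewrite /fmap/=; apply: filterE => x; exact: (pA x).1.
have [z [_ zU]] := cset_compact (fmap_proper_filter p _) pUA.
exists z.
have [Uz|Uz] := in_ultra_setVsetC (p @^-1` ball z (e / 2)) UU.
  near=> x.
  have zp : ball z (e / 2) (p x) by near: x.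
  have xA : dist_to_set x A < e / 2 by near: x.
  rewrite [e]splitr; apply: ball_triangle zp _; apply: ball_sym.
  by rewrite ballEmdist/=; exact: (pA x).2.
have [|y []] := zU (~` ball z (e / 2)) (ball z (e / 2)) Uz; last by [].
by apply: nbhsx_ballx; rewrite divr_gt0.
Unshelve. all: by end_near. Qed.

Lemma compacts_complete (R : realType) (X : completeMetricType R)
    (Phi : set_system (compacts X)) :
  ProperFilter Phi -> cauchy Phi -> cvg Phi.
Proof.
move=> PF /cauchyP Phi_cauchy.
have Phi_ball (e : R) : 0 < e ->
    exists B0 : compacts X,
      \forall B \near Phi, hausdorff_dist (cset B0) (cset B) < e.
  move=> e0; have [B0 PB0] := Phi_cauchy _ e0.
  by exists B0; move: PB0; rewrite ballEmdist.
pose A := [set x : X | forall e : R, 0 < e ->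
  \forall B \near Phi, dist_to_set x (cset B) < e].
have A_near (e : R) (x : X) (B0 : compacts X) : A x ->
    (\forall B \near Phi, hausdorff_dist (cset B0) (cset B) < e) ->
    dist_to_set x B0 <= e.
  move=> Ax PB0; apply/ler_addgt0Pl => d d0.
  have [B [dB]] := filter_ex (filterI (Ax _ d0) PB0).
  move=> /ltW B0B; rewrite (le_trans (dist_to_set_lipschitz B B0 x))//.
  by rewrite hausdorff_dist_sym lerD// ltW.
have near_A (e : R) (x : X) (B0 : compacts X) :
    cset B0 x -> 0 < e ->
    (\forall B \near Phi, hausdorff_dist (cset B0) (cset B) < e) ->
    exists2 y, A y & mdist x y <= e.
  move=> B0x e0 PB0.
  have [G [GU PG]] := ultraFilterLemma PF.
  have /choice[p pG] : forall C : compacts X, exists y, cset C y /\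
      (hausdorff_dist B0 C < e -> mdist x y < e).
    move=> C; have [B0C|_] := ltP (hausdorff_dist B0 C) e.
      have [|y Cy xy] := @dist_to_set_lt _ _ C x e; last by exists y.
      by rewrite (le_lt_trans _ B0C)// dist_to_set_le_hausdorff.
    by have [y Cy] := cset_nonempty C; exists y.
  have pGU : UltraFilter (p @ G).
    split; first exact: fmap_proper_filter.
    move=> H HF GH; apply/seteqP; split => // S HS.
    have [//|GS] := in_ultra_setVsetC (p @^-1` S) GU.
    have : H (S `&` ~` S) by apply: filterI => //; exact: GH.
    by rewrite setICr => /filter_not_empty.
  have /cvg_ex[y Gy] : cvg (p @ G).
    apply: ultra_cvg_near_compacts => d d0.
    have [B1 PB1] := Phi_ball _ d0; exists B1.
    rewrite /fmap/=; apply: filterS (PG _ PB1) => C B1C.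
    rewrite /= (le_lt_trans (dist_to_set_le_hausdorff B1 (pG C).1))//.
    by rewrite hausdorff_dist_sym.
  have {}Gy (d : R) : 0 < d -> \forall C \near G, mdist y (p C) < d.
    by move=> d0; exact: metricType_numDomainType.cvgr_dist_lt Gy _ d0.
  exists y.
    move=> d d0.
    have d3 : 0 < d / 3 by rewrite divr_gt0.
    have [B1 PB1] := Phi_ball _ d3.
    have [C [yC B1C]] := filter_ex (filterI (Gy _ d3) (PG _ PB1)).
    apply: filterS PB1 => B B1B.
    rewrite (le_lt_trans (dist_to_set_lipschitz B1 B y))//.
    have := dist_to_set_lipschitz C B1 y.
    have := dist_to_set_le y (pG C).1.
    by move: yC B1C B1B; rewrite (hausdorff_dist_sym B1 C); lra.
  apply/ler_addgt0Pl => d d0.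
  have [C [yC B0C]] := filter_ex (filterI (Gy _ d0) (PG _ PB0)).
  have := (pG C).2 B0C; have := mdist_triangle (p C) x y.
  by rewrite (mdistC (p C)); move: yC; lra.
have A_nonempty : A !=set0.
  have [B0 PB0] := Phi_ball 1 ltr01.
  have [x B0x] := cset_nonempty B0.
  by have [y Ay _] := near_A _ _ _ B0x ltr01 PB0; exists y.
have A_closed : closed A.
  move=> x clx e e0.
  have e2 : 0 < e / 2 by rewrite divr_gt0.
  have [y [Ay]] := clx _ (nbhsx_ballx x _ e2); rewrite ballEmdist/= => xy.
  apply: filterS (Ay _ e2) => B yB.
  rewrite (le_lt_trans (dist_to_set_triangle x y B))//.
  by rewrite [e]splitr ltrD.
have A_compact : compact A.
  rewrite compact_ultra => U UU UA.
  have : cvg U.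
    apply: ultra_cvg_near_compacts => e e0.
    have e2 : 0 < e / 2 by rewrite divr_gt0.
    have [B0 PB0] := Phi_ball _ e2; exists B0.
    apply: filterS UA => x Ax; rewrite /= (le_lt_trans (A_near _ _ _ Ax PB0))//.
    by rewrite ltr_pdivrMr// ltr_pMr// ltr1n.
  move=> /cvg_ex[l Ul]; exists l; split => //.
  by apply: A_closed => N /Ul UN; exact: filter_ex (filterI UA UN).
have [K KA] : exists K : compacts X, cset K = A.
  by exists (Compacts A_compact A_nonempty).
apply/cvg_ex; exists K.
apply/metricType_numDomainType.fcvgrPdist_lt => e e0.
have e4 : 0 < e / 4 by rewrite divr_gt0.
have [B0 PB0] := Phi_ball _ e4.
apply: filterS (PB0) => B B0B; rewrite mdist_compactsE.
have : hausdorff_dist K B0 <= e / 4.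
  apply: hausdorff_dist_le => x.
    by rewrite KA => /A_near; exact.
  move=> /near_A/(_ e4 PB0)[y Ay xy].
  by rewrite (le_trans _ xy)// dist_to_set_le// KA.
have := hausdorff_dist_triangle B0 K B.
by move: B0B; lra.
Qed.

Lemma powR_le_near_right (R : realType) (c p e : R) :
  0 <= c -> 0 < p -> 0 < e ->
  exists2 d, 0 < d & forall x, 0 <= x -> x <= c + d -> x `^ p <= c `^ p + e.
Proof.
move=> c0 p0 e0.
have cp0 := powR_ge0 c p.
have ce0 : 0 < c `^ p + e by rewrite ltr_wpDl.
have rootK (y : R) : 0 <= y -> (y `^ p) `^ p^-1 = y.
  by move=> y0; rewrite -powRrM divff ?gt_eqF// powRr1.
exists ((c `^ p + e) `^ p^-1 - c) => [|x x0].
  rewrite subr_gt0 -[ltLHS]rootK//; apply: gt0_ltr_powR.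
  - by rewrite invr_gt0.
  - by rewrite nnegrE.
  - by rewrite nnegrE ltW.
  - by rewrite ltrDl.
rewrite addrC subrK => xc.
have /= := ge0_ler_powR (ltW p0) _ _ xc.
rewrite !nnegrE -powRrM mulVf ?gt_eqF// powRr1 ?(ltW ce0)//.
by apply => //; exact: powR_ge0.
Qed.

Lemma esum_itv_cat (R : realType) (h : R -> \bar R) (s x t : R) :
  (forall y, (0 <= h y)%E) -> s <= x -> x <= t ->
  \esum_(y in `[s, t[) h y =
  (\esum_(y in `[s, x[) h y + \esum_(y in `[x, t[) h y)%E.
Proof.
move=> h0 sx xt; rewrite (esumID `[s, x[%classic)//.
congr (_ + _)%E; congr (esum _ _); apply/seteqP; split => y /=;
  rewrite !in_itv/=.
- by move=> [].
- by move=> /andP[sy yx]; rewrite sy yx (lt_le_trans yx xt).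
- by move=> [/andP[sy yt] /negP]; rewrite sy/= -leNgt => ->.
- move=> /andP[xy yt]; rewrite (le_trans sx xy) yt; split => //.
  by rewrite ltNge xy.
Qed.

Lemma mvariation_cons (R : realType) (M : metricType R) (F : R -> M) (s t x : R)
    (p : seq R) :
  mvariation s t F (x :: p) = mdist (F s) (F x) + mvariation x t F p.
Proof. by rewrite /mvariation/= big_nat_recl. Qed.

Lemma mvariation_ge0 (R : realType) (M : metricType R) (F : R -> M) (s t : R)
  (p : seq R) : 0 <= mvariation s t F p.
Proof. by apply: sumr_ge0 => i _; exact: mdist_ge0. Qed.

Lemma total_mvariation_ge0 (R : realType) (M : metricType R) (F : R -> M)
  (s t : R) : s <= t -> (0 <= total_mvariation s t F)%E.
Proof.
move=> st; have [p pst] : exists p, itv_partition s t p.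
  move: st; rewrite le_eqVlt => /predU1P[->|st].
    by exists [::]; split => /=.
  by exists [:: t]; exact: itv_partition1.
apply: le_ereal_sup_tmp; exists (mvariation s t F p)%:E; first by exists p.
by rewrite lee_fin mvariation_ge0.
Qed.

Lemma total_mvariation_cons (R : realType) (M : metricType R) (F : R -> M)
    (s u t : R) : s < u ->
  ((mdist (F s) (F u))%:E + total_mvariation u t F <= total_mvariation s t F)%E.
Proof.
move=> su; rewrite -leeBrDl//; apply: ge_ereal_sup => _ [p [up /= pt] <-].
rewrite EFinN leeBrDl//; apply: le_ereal_sup_tmp.
exists (mvariation s t F (u :: p))%:E; last by rewrite mvariation_cons EFinD.
by exists (u :: p) => //; split => //=; rewrite su.
Qed.

Lemma total_mvariation_le (R : realType) (M : metricType R) (F : R -> M)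
    (s u t : R) : s <= u ->
  (total_mvariation u t F <= total_mvariation s t F)%E.
Proof.
rewrite le_eqVlt => /predU1P[->//|su].
apply: le_trans (total_mvariation_cons F t su).
by rewrite leeDr// lee_fin mdist_ge0.
Qed.

Lemma jump_total_mvariation (R : realType) (M : metricType R) (F : R -> M)
    (Fp : M) (s u t : R) : F @ s^'+ --> Fp -> s < u ->
  ((mdist Fp (F s))%:E + total_mvariation u t F <= total_mvariation s t F)%E.
Proof.
move=> FFp su; apply/lee_addgt0Pr => e e0.
near s^'+ => r.
have sr : s < r by near: r; exact: nbhs_right_gt.
have ru : r <= u by near: r; exact: nbhs_right_le.
have Fr : mdist Fp (F r) <= e.
  near: r; exact: metricType_numDomainType.cvgr_dist_le FFp _ e0.
apply: (@le_trans _ _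
    ((mdist (F s) (F r))%:E + total_mvariation r t F + e%:E)%E).
  rewrite [leRHS]addeAC leeD ?total_mvariation_le// -EFinD lee_fin.
  by have := mdist_triangle (F r) Fp (F s); rewrite (mdistC (F s)); lra.
by rewrite leeD2r// total_mvariation_cons.
Unshelve. all: by end_near. Qed.

Lemma sum_jump_total_mvariation (R : realType) (M : metricType R)
    (F Fp : R -> M) (s t : R) (l : seq R) :
  s <= t -> path <=%R s l -> uniq l ->
  (forall x, x \in l -> x < t /\ F @ x^'+ --> Fp x) ->
  (\sum_(x <- l) (mdist (Fp x) (F x))%:E <= total_mvariation s t F)%E.
Proof.
elim: l s => [|x l IH] s st /=.
  by rewrite big_nil => _ _ _; exact: total_mvariation_ge0.
move=> /andP[sx xl] /andP[xNl ul] lt; rewrite big_cons.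
have [xt FFp] := lt x (mem_head _ _).
apply: le_trans (total_mvariation_le F t sx).
have [u [xu ut lu]] : exists u, [/\ x < u, u <= t & path <=%R u l].
  case: l xl xNl ul lt {IH} => [|y l] /=; first by exists t.
  move=> /andP[xy yl] xNl _ lt; exists y; split => //.
  - rewrite lt_neqAle xy andbT; apply: contraNneq xNl => ->; exact: mem_head.
  - by apply/ltW; apply: (lt y _).1; rewrite !inE eqxx orbT.
  - by rewrite lexx.
apply: le_trans (jump_total_mvariation t FFp xu).
by rewrite leeD2l// IH// => y yl; apply: lt; rewrite inE yl orbT.
Qed.

Lemma esum_jump_total_mvariation (R : realType) (M : metricType R)
    (F Fp : R -> M) (s t : R) : s <= t ->
  (forall x, x \in `[s, t[ -> F @ x^'+ --> Fp x) ->
  (\esum_(x in `[s, t[) (mdist (Fp x) (F x))%:E <= total_mvariation s t F)%E.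
Proof.
move=> st FFp; apply: ge_ereal_sup => _ [A [finA Ast] <-].
rewrite fsbig_finite//=.
rewrite -(perm_big _ (permEl (perm_sort <=%R (fset_set A))))/=.
have sortA x : x \in sort <=%R (fset_set A) -> x \in `[s, t[.
  by rewrite mem_sort in_fset_set// => /set_mem /Ast.
apply: sum_jump_total_mvariation => //.
- rewrite le_path_sortedE sort_le_sorted andbT; apply/allP => x /sortA.
  by rewrite in_itv => /andP[].
- by rewrite sort_uniq fset_uniq.
- move=> x /sortA xst; split; last exact: FFp.
  by move: xst; rewrite in_itv => /andP[].
Qed.

Lemma total_mvariation_le_superadditive (R : realType) (M : metricType R)
    (F : R -> M) (h : R -> \bar R) (s t : R) : (forall x, (0 <= h x)%E) ->
  (forall x y, s <= x -> x < y -> y <= t ->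
    ((mdist (F x) (F y))%:E <= \esum_(z in `[x, y[) h z)%E) ->
  (total_mvariation s t F <= \esum_(z in `[s, t[) h z)%E.
Proof.
move=> h0 Fh; apply: ge_ereal_sup => _ [p pst <-].
elim: p s pst Fh => [|x p IH] s pst Fh.
  by rewrite /mvariation big_geq// esum_ge0.
have xpt := itv_partition_cons pst.
have xt := itv_partition_le xpt.
have sx : s < x by case: pst => /= /andP[].
rewrite mvariation_cons EFinD (esum_itv_cat h0 (ltW sx) xt) leeD ?Fh//.
by apply: IH => // y z xy; apply: Fh; rewrite (le_trans (ltW sx)).
Qed.

Lemma esumZl_le (R : realType) (T : choiceType) (I : set T) (h : T -> \bar R)
    (c : R) : 0 <= c -> (forall x, 0 <= h x)%E ->
  (\esum_(x in I) (c%:E * h x) <= c%:E * \esum_(x in I) h x)%E.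
Proof.
move=> c0 h0; apply: ge_ereal_sup => _ [A [finA AI] <-].
rewrite -ge0_mule_fsumr// lee_wpmul2l ?lee_fin//.
by apply: ereal_sup_ubound; exists A.
Qed.

Section holder.
Context {R : realType} {M : metricType R} {a b alpha L : R}.
Context {g gp : R -> R} {F Fp : R -> M}.
Hypothesis alpha_gt1 : 1 < alpha.
Hypothesis g_nondecreasing : {in `[a, b] &, {homo g : x y / x <= y}}.
Hypothesis g_left : forall tau, tau \in `]a, b] -> g @ tau^'- --> g tau.
Hypothesis g_right : forall tau, tau \in `[a, b[ -> g @ tau^'+ --> gp tau.
Hypothesis F_holder : holder_bounds a b alpha g F L.

Let L_ge0 : 0 <= L. Proof. exact: F_holder.1. Qed.

Let alpha_gt0 : 0 < alpha. Proof. exact: lt_trans alpha_gt1. Qed.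

Lemma holder_dist x y : a <= x -> x <= y -> y <= b ->
  mdist (F x) (F y) <= L * (g y - g x) `^ alpha.
Proof.
move=> ax xy yb; have xI : x \in `[a, b] by rewrite in_itv/= ax (le_trans xy).
have yI : y \in `[a, b] by rewrite in_itv/= yb (le_trans ax).
by rewrite -[g y - g x]ger0_norm ?subr_ge0 ?g_nondecreasing// F_holder.2.
Qed.

Lemma holder_modulus p c e : 0 < p -> 0 <= c -> 0 < e -> exists2 d, 0 < d &
  forall x, 0 <= x -> x <= c + d -> L * x `^ p <= L * c `^ p + e.
Proof.
move=> p0 c0 e0; have L1 : 0 < L + 1 by rewrite ltr_wpDl.
have [|d d0 cd] := @powR_le_near_right _ c p (e / (L + 1)) c0 p0.
  by rewrite divr_gt0.
exists d => // x x0 xcd; have := ler_wpM2l L_ge0 (cd x x0 xcd).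
move=> /le_trans; apply; rewrite mulrDr lerD2l mulrCA ler_piMr ?(ltW e0)//.
by rewrite ler_pdivrMr// mul1r lerDl.
Qed.

Lemma right_limit_le tau r : a <= tau -> tau < r -> r <= b -> gp tau <= g r.
Proof.
move=> ta tr rb; apply: (cvgr_to_le (g_right _)).
  by rewrite in_itv/= ta (lt_le_trans tr).
near=> x; have tx : tau < x by near: x; exact: nbhs_right_gt.
have xr : x <= r by near: x; exact: nbhs_right_le.
by apply: g_nondecreasing => //; rewrite in_itv/=; apply/andP; split; lra.
Unshelve. all: by end_near. Qed.

Lemma right_limit_ge tau : tau \in `[a, b[ -> g tau <= gp tau.
Proof.
move=> tI; apply: (cvgr_to_ge (g_right tI)).
move: tI; rewrite in_itv/= => /andP[ta tb].
near=> x; have tx : tau < x by near: x; exact: nbhs_right_gt.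
have xr : x <= b by near: x; exact: nbhs_right_le.
by apply: g_nondecreasing; rewrite ?in_itv//=; apply/andP; split; lra.
Unshelve. all: by end_near. Qed.

Lemma holder_right_cauchy tau : tau \in `[a, b[ -> cauchy (F @ tau^'+).
Proof.
move=> tI; apply/cauchy_exP => e e0.
have e2 : 0 < e / 2 by rewrite divr_gt0.
have [d d0 Ld] := holder_modulus alpha_gt0 (lexx 0) e2.
have /cvgrPdist_lt/(_ _ d0) gd := g_right tI.
move: tI; rewrite in_itv/= => /andP[ta tb].
near tau^'+ => r.
have tr : tau < r by near: r; exact: nbhs_right_gt.
have rb : r <= b by near: r; exact: nbhs_right_le.
exists (F r); near=> x.
have tx : tau < x by near: x; exact: nbhs_right_gt.
have xr : x <= r by near: x; exact: nbhs_right_le.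
rewrite ballEmdist/= mdistC.
have gr : `|gp tau - g r| < d by near: r.
have /le_lt_trans : mdist (F x) (F r) <= e / 2.
  rewrite (le_trans (holder_dist _ xr rb)) ?(le_trans ta (ltW tx))//.
  have gxr : g x <= g r.
    by apply: g_nondecreasing; rewrite ?in_itv//=; apply/andP; split; lra.
  have := Ld (g r - g x); rewrite powR0 ?gt_eqF// mulr0 !add0r; apply.
    by rewrite subr_ge0.
  have := right_limit_le ta tx (le_trans xr rb).
  by move: gr; rewrite distrC => /ltr_normlW; lra.
by apply; rewrite gtr_pMr// invf_lt1// ltr1n.
Unshelve. all: by end_near. Qed.

Hypothesis F_right : forall tau, tau \in `[a, b[ -> F @ tau^'+ --> Fp tau.

Lemma jump_le tau : tau \in `[a, b[ ->
  mdist (Fp tau) (F tau) <= L * (gp tau - g tau) `^ alpha.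
Proof.
move=> tI; apply/ler_addgt0Pr => e e0.
have e2 : 0 < e / 2 by rewrite divr_gt0.
have gp_g : 0 <= gp tau - g tau by rewrite subr_ge0 right_limit_ge.
have [d d0 Ld] := holder_modulus alpha_gt0 gp_g e2.
have /cvgrPdist_le/(_ _ d0) gd := g_right tI.
have Fd := metricType_numDomainType.cvgr_dist_le (F_right tI) e2.
move: tI; rewrite in_itv/= => /andP[ta tb].
near tau^'+ => r.
have tr : tau < r by near: r; exact: nbhs_right_gt.
have rb : r <= b by near: r; exact: nbhs_right_le.
have gr : `|gp tau - g r| <= d by near: r.
have Fr : mdist (Fp tau) (F r) <= e / 2 by near: r; exact: Fd.
have gtr : g tau <= g r.
  by apply: g_nondecreasing; rewrite ?in_itv//=; apply/andP; split; lra.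
have Ftr := holder_dist ta (ltW tr) rb.
have {}Ld : L * (g r - g tau) `^ alpha <= L * (gp tau - g tau) `^ alpha + e / 2.
  apply: Ld; first by rewrite subr_ge0.
  by move: gr; rewrite distrC => /ler_normlW; lra.
have := mdist_triangle (F r) (Fp tau) (F tau).
by rewrite (mdistC (F r) (F tau)); lra.
Unshelve. all: by end_near. Qed.

Lemma holder_right_dist tau t : a <= tau -> tau < t -> t <= b ->
  mdist (Fp tau) (F t) <= L * (g t - gp tau) `^ alpha.
Proof.
move=> ta tt tb; apply/ler_addgt0Pl => e e0.
have tI : tau \in `[a, b[ by rewrite in_itv/= ta (lt_le_trans tt).
have Fd := metricType_numDomainType.cvgr_dist_le (F_right tI) e0.
near tau^'+ => r.
have tr : tau < r by near: r; exact: nbhs_right_gt.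
have rt : r <= t by near: r; exact: nbhs_right_le.
have Fr : mdist (Fp tau) (F r) <= e by near: r; exact: Fd.
rewrite (le_trans (mdist_triangle (F r) _ _))// lerD//.
rewrite (le_trans (holder_dist _ rt tb))// ?(le_trans ta (ltW tr))//.
rewrite ler_wpM2l// ge0_ler_powR ?(ltW alpha_gt0)// ?nnegrE ?subr_ge0.
- by apply: g_nondecreasing => //; rewrite in_itv/=; apply/andP; split; lra.
- exact: right_limit_le.
- by rewrite lerD2l lerN2 right_limit_le// (le_trans rt).
Unshelve. all: by end_near. Qed.

(* This is where [1 < alpha] is used: past its jump at [c], [F] moves by
   [O(u ^ alpha) = o(u)] while [g] moves by [u]. *)
Lemma holder_right_step c e : c \in `[a, b[ -> 0 < e ->
  \forall y \near c^'+,
    mdist (F c) (F y) <= mdist (Fp c) (F c) + e * (g y - g c).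
Proof.
move=> cI e0.
have alpha1 : 0 < alpha - 1 by rewrite subr_gt0.
have [d d0 Ld] := holder_modulus alpha1 (lexx 0) e0.
have /cvgrPdist_le/(_ _ d0) gd := g_right cI.
have gcp := right_limit_ge cI.
move: cI; rewrite in_itv/= => /andP[ac cb].
near=> y.
have cy : c < y by near: y; exact: nbhs_right_gt.
have yb : y <= b by near: y; exact: nbhs_right_le.
have gy : `|gp c - g y| <= d by near: y.
have gpy := right_limit_le ac cy yb.
rewrite (le_trans (mdist_triangle (Fp c) _ _))// mdistC lerD2l.
rewrite (le_trans (holder_right_dist ac cy yb))//.
rewrite -mulr_powRB1 ?subr_ge0// mulrCA mulrC.
have {}Ld : L * (g y - gp c) `^ (alpha - 1) <= e.
  have := Ld (g y - gp c); rewrite powR0 ?gt_eqF// mulr0 !add0r subr_ge0.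
  by apply=> //; move: gy; rewrite distrC => /ler_normlW.
rewrite (@le_trans _ _ (e * (g y - gp c)))//.
  by rewrite ler_wpM2r// subr_ge0.
by rewrite ler_wpM2l ?(ltW e0)//; lra.
Unshelve. all: by end_near. Qed.

Lemma holder_left_step c e : c \in `]a, b] -> 0 < e ->
  \forall x \near c^'-, mdist (F x) (F c) <= e.
Proof.
move=> cI e0.
have [d d0 Ld] := holder_modulus alpha_gt0 (lexx 0) e0.
have /cvgrPdist_le/(_ _ d0) gd := g_left cI.
move: cI; rewrite in_itv/= => /andP[ac cb].
near=> x.
have xc : x < c by near: x; exact: nbhs_left_lt.
have ax : a <= x by near: x; exact: nbhs_left_ge.
have gx : `|g c - g x| <= d by near: x.
have gxc : g x <= g c.
  by apply: g_nondecreasing; rewrite ?in_itv//=; apply/andP; split; lra.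
rewrite (le_trans (holder_dist ax (ltW xc) cb))//.
have := Ld (g c - g x); rewrite powR0 ?gt_eqF// mulr0 !add0r subr_ge0.
apply=> //; exact: ler_normlW.
Unshelve. all: by end_near. Qed.

(* Continuous induction on [x]: the set of good [x] is closed under left limits
   because [F] and [g] are left-continuous, and [holder_right_step] pushes it
   to the right. *)
Lemma holder_dist_le_jumps_eps s t e : a <= s -> s <= t -> t <= b -> 0 < e ->
  ((mdist (F s) (F t))%:E <=
   \esum_(x in `[s, t[) (mdist (Fp x) (F x))%:E + (e * (g t - g s))%:E)%E.
Proof.
move=> sa st tb e0.
pose J x : \bar R := (mdist (Fp x) (F x))%:E.
have J0 x : (0 <= J x)%E by rewrite lee_fin mdist_ge0.
pose E := [set x | s <= x <= t /\
  ((mdist (F s) (F x))%:E <=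
   \esum_(z in `[s, x[) J z + (e * (g x - g s))%:E)%E].
have Es : E s.
  split; first by rewrite lexx.
  by rewrite mdistxx subrr mulr0 adde0 esum_ge0.
have Esup : has_sup E.
  by split; [exists s|exists t => x [/andP[]]].
pose c := sup E.
have sc : s <= c by exact: ub_le_sup Esup.2 _ Es.
have ct : c <= t by apply: ge_sup Esup.1 _ => x [/andP[]].
have Ec : E c.
  have [//|NEc] := pselect (E c).
  have sltc : s < c.
    by rewrite lt_neqAle sc andbT; apply/eqP => scE; apply: NEc; rewrite -scE.
  split; first by rewrite sc.
  apply/lee_addgt0Pr => d d0.
  have cI : c \in `]a, b] by rewrite in_itv/= (le_lt_trans sa) ?(le_trans ct).
  have [r r0 cr] : exists2 r, 0 < r &
      forall x, c - r < x -> x < c -> mdist (F x) (F c) <= d.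
    have [r /= r0 cr] := holder_left_step cI d0; exists r => // x crx xc.
    by apply: cr => //=; rewrite ger0_norm ?subr_ge0 ?ltW//; lra.
  have [x Ex crx] := sup_adherent r0 Esup.
  have xc : x < c.
    rewrite lt_neqAle ub_le_sup ?andbT//; last exact: Esup.2.
    by apply/eqP => xcE; apply: NEc; rewrite -xcE.
  have [/andP[sx xt] sxE] := Ex.
  rewrite (@le_trans _ _ ((mdist (F s) (F x))%:E + d%:E)%E)//.
    rewrite -EFinD lee_fin (le_trans (mdist_triangle (F x) _ _))// lerD2l.
    exact: cr.
  rewrite leeD2r// (le_trans sxE)//.
  rewrite (esum_itv_cat J0 sx (ltW xc)) leeD ?leeDl ?esum_ge0// lee_fin.
  rewrite ler_wpM2l ?(ltW e0)// lerD2r.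
  by apply: g_nondecreasing; rewrite ?in_itv ?(ltW xc)//=; apply/andP;
    split; lra.
have [cltt|tc] := ltP c t; last first.
  have <- : c = t by apply/eqP; rewrite eq_le ct tc.
  exact: Ec.2.
have cI : c \in `[a, b[ by rewrite in_itv/= (le_trans sa sc) (lt_le_trans cltt).
have cstep := holder_right_step cI e0.
near c^'+ => y.
have cy : c < y by near: y; exact: nbhs_right_gt.
have yt : y <= t by near: y; exact: nbhs_right_le.
have : E y.
  split; first by rewrite yt (le_trans sc (ltW cy)).
  rewrite (@le_trans _ _ ((mdist (F s) (F c))%:E + (mdist (F c) (F y))%:E)%E)//.
    by rewrite -EFinD lee_fin mdist_triangle.
  have Fcy : mdist (F c) (F y) <= mdist (Fp c) (F c) + e * (g y - g c).
    by near: y.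
  rewrite (esum_itv_cat J0 sc (ltW cy)).
  have -> : e * (g y - g s) = e * (g c - g s) + e * (g y - g c) by ring.
  rewrite EFinD addeACA leeD ?Ec.2//.
  rewrite -lee_fin in Fcy; rewrite (le_trans Fcy)// EFinD leeD2r//.
  rewrite (esumID [set c])//; rewrite -[leLHS]adde0 leeD ?esum_ge0//.
  have -> : `[c, y[%classic `&` [set c] = [set c].
    by apply/seteqP; split => [z []//|_ /= ->]; rewrite in_itv/= lexx cy.
  by rewrite esum_set1.
by move=> /(ub_le_sup Esup.2); rewrite leNgt cy.
Unshelve. all: by end_near. Qed.

Lemma holder_dist_le_jumps s t : a <= s -> s <= t -> t <= b ->
  ((mdist (F s) (F t))%:E <= \esum_(x in `[s, t[) (mdist (Fp x) (F x))%:E)%E.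
Proof.
move=> sa st tb; apply/lee_addgt0Pr => e e0.
have gst : g s <= g t.
  by apply: g_nondecreasing; rewrite ?in_itv//=; apply/andP; split; lra.
have G0 : 0 < g t - g s + 1 by lra.
have eG : 0 < e / (g t - g s + 1) by rewrite divr_gt0.
rewrite (le_trans (holder_dist_le_jumps_eps sa st tb eG))// leeD2l// lee_fin.
by rewrite -mulrA ler_piMr ?(ltW e0)// mulrC ler_pdivrMr// mul1r lerDl.
Qed.

End holder.

Lemma nondecreasing_right_is_cvg (R : realType) (a b : R) (g : R -> R) tau :
  {in `[a, b] &, {homo g : x y / x <= y}} -> tau \in `[a, b[ ->
  cvg (g @ tau^'+).
Proof.
move=> g_nd; rewrite in_itv/= => /andP[ta tb].
have itvW x : x \in `]tau, b[ -> x \in `[a, b].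
  by rewrite !in_itv/= => /andP[tx xb]; rewrite (ltW xb) (le_trans ta (ltW tx)).
have tb' : (BRight tau < BLeft b)%O by rewrite bnd_simp.
apply/cvg_ex; eexists; apply: (nondecreasing_at_right_cvgr tb').
- by move=> x y /itvW xI /itvW yI; exact: g_nd.
- exists (g tau) => _ [x /= xI <-]; apply: g_nd; last 2 first.
  + exact: itvW.
  + by move: xI; rewrite in_itv/= => /andP[/ltW].
  + by rewrite in_itv/= ta ltW.
Qed.

Theorem theorem9p4 (R : realType) (X : completeMetricType R) (a b alpha : R)
    (g : R -> R) (F : R -> compacts X)
    (ab : a <= b)
    (g_left_continuous : forall tau, tau \in `]a, b] -> g @ tau^'- --> g tau)
    (g_nondecreasing : {in `[a, b] &, {homo g : x y / x <= y}})
    (alpha_gt1 : 1 < alpha)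
    (F_holder : gholder a b alpha g F) :
  (forall tau, tau \in `[a, b[ -> cvg (F @ tau^'+)) /\
  forall s t, a <= s -> s < t -> t <= b ->
  [/\ total_mvariation s t F = \esum_(tau in `[s, t[) (set_jump F tau)%:E,
      \esum_(tau in `[s, t[) (set_jump F tau)%:E =
      \esum_(tau in `[s, t[) (hausdorff_dist (lim (F @ tau^'+)) (F tau))%:E
    & (\esum_(tau in `[s, t[) (set_jump F tau)%:E <=
       (holder_const a b alpha g F)%:E *
       \esum_(tau in `[s, t[) (right_jump g tau `^ alpha)%:E)%E].
Proof.
have [L_bound _] := holder_const_minimum F_holder.
have g_right tau : tau \in `[a, b[ -> g @ tau^'+ --> lim (g @ tau^'+).
  exact: nondecreasing_right_is_cvg g_nondecreasing.
have F_right tau : tau \in `[a, b[ -> cvg (F @ tau^'+).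
  move=> tI; apply: compacts_complete.
  exact: (holder_right_cauchy alpha_gt1 g_nondecreasing g_right L_bound tI).
split=> // s t sa st tb.
have itvW tau : tau \in `[s, t[ -> tau \in `[a, b[.
  rewrite !in_itv/= => /andP[stau taut].
  by rewrite (le_trans sa stau) (lt_le_trans taut tb).
split=> //.
- apply/eqP; rewrite eq_le; apply/andP; split.
    apply: total_mvariation_le_superadditive => [x|x y sx xy yt].
      by rewrite lee_fin hausdorff_dist_ge0.
    apply: (holder_dist_le_jumps alpha_gt1 g_nondecreasing g_left_continuous
      g_right L_bound F_right (le_trans sa sx) (ltW xy) (le_trans yt tb)).
  apply: (esum_jump_total_mvariation (Fp := fun tau => lim (F @ tau^'+))
    (ltW st)).
  by move=> tau /itvW; exact: F_right.
- apply: le_trans (esumZl_le _ L_bound.1 _) => [|tau]; last first.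
    by rewrite lee_fin powR_ge0.
  apply: le_esum => tau /itvW tI; rewrite -EFinM lee_fin.
  exact: (jump_le alpha_gt1 g_nondecreasing g_right L_bound F_right tI).
Qed.
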